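(* Let $(\mathfrak g,V,\Theta)$ be a Lie–Leibniz triple such that $\mathfrak g$ is a simple Lie algebra, $V$ is a faithful $\mathfrak g$-module, and $\Theta\neq0$. Then there is a subspace $T_{-1}$ of $\mathrm{Hom}(V[-1],\mathrm{End}\,V[-1])$ such that $L(\mathfrak g,V,\Theta)$ is isomorphic, as a Lie superalgebra, to $P(V[-1],T_{-1})$.
   Context: Ground field $\mathbb{K}=\mathbb{R}$ or $\mathbb{C}$; all spaces $\mathbb{Z}$-graded with parity equal to degree mod 2; subalgebras and ideals are graded; isomorphisms preserve degree. $V[-1]$ denotes $V$ placed in degree 1 (odd). A Lie–Leibniz triple $(\mathfrak g,V,\Theta)$ consists of a Lie algebra $\mathfrak g$, a $\mathfrak g$-module $V$ (action $x\cdot u$) and a linear map $\Theta:V\to\mathfrak g$ with $\Theta(\Theta(u)\cdot v)=[\Theta(u),\Theta(v)]$ for all $u,v$. Construction of $\mathbb U$: $\mathbb U_0=\mathfrak g$, $\mathbb U_1=V[-1]$, $\mathbb U_{-p+1}=\mathrm{Hom}(\mathbb U_1,\mathbb U_{-p+2})$ for $p\ge2$; brackets on $\mathbb U_{1-}=\bigoplus_{k\le1}\mathbb U_k$: Lie bracket on $\mathfrak g$, and recursively $[x,u]=x(u)$, $[u,x]=-(-1)^{|x|}x(u)$, $[x,y](u)=[x,y(u)]+(-1)^{|y|}[x(u),y]$ for $x,y\in\mathbb U_{0-}$, $u\in\mathbb U_1$, where $x(u)=x\cdot u$ for $x\in\mathfrak g$; $\mathbb U$ is the unique Lie superalgebra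 extending this semilocal Lie superalgebra with $\mathbb U_+$ free on $\mathbb U_1$. $\Theta$ is regarded as an element of $\mathbb U_{-1}$; $R_\Theta\subseteq\mathbb U_{-1}$ is the $\mathfrak g$-submodule generated by $\Theta$ under $x\cdot\phi=[x,\phi]$. Let $\sigma:\mathbb U_2\to\mathbb U_1$ be linear with $\sigma([u,v])=\tfrac12(\Theta(u)\cdot v+\Theta(v)\cdot u)$, and $K$ the sum of all $\mathfrak g$-submodules of $\mathbb U_2$ contained in $\ker\sigma$. Construction of $L$: let $\mathbb S$ be the subalgebra of $\mathbb U$ generated by $R_\Theta\oplus\mathfrak g\oplus\mathbb U_1$; let $\mathscr K$ be the ideal of $\mathbb S$ generated by $K$; $\mathbb T=\mathbb S/\mathscr K$; and $L(\mathfrak g,V,\Theta)=\mathbb T/J$, where $J$ is the sum of all ideals of $\mathbb T$ contained in $\mathbb T_{3+}=\bigoplus_{k\ge3}\mathbb T_k$. Construction of $P$: for $W=V[-1]$, let $U$ be the universal Lie superalgebra associated to $U_1=W$: $U_0=\mathrm{End}(U_1)$, $U_{-p+1}=\mathrm{Hom}(U_1,U_{-p+2})$ for $p\ge2$ (so $U_{-1}=\mathrm{Hom}(W,\mathrm{End}\,W)$), with brackets on $U_{1-}$ given recursively by $[x,u]=x(u)$, $[u,x]=-(-1)^{|x|}x(u)$, $[x,y](u)=[x,y(u)]+(-1)^{|y|}[x(u),y]$ ($x,y\in U_{0-}$, $u\in U_1$), extended uniquely to a Lie superalgebra $U$ with $U_+$ free on $U_1$. For a subspace $T_{-1}\subseteq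 U_{-1}$, $\tilde P(W,T_{-1})$ is the subalgebra of $U$ generated by $U_1$ and $T_{-1}$, and $P(W,T_{-1})=\tilde P(W,T_{-1})/I$, where $I$ is the maximal ideal of $\tilde P(W,T_{-1})$ intersecting its degree $-1,0,1$ part trivially. *)

(* Defs.v *)
From HB Require Import structures.
From mathcomp Require Import all_boot all_order all_algebra.
From mathcomp Require Import reals.
From mathcomp.real_closed Require Import complex.
Set Implicit Arguments. Unset Strict Implicit. Unset Printing Implicit Defensive.
Import Order.TTheory GRing.Theory Num.Theory.
Local Open Scope ring_scope.

Definition ground (R : realType) (b : bool) : fieldType :=
  if b then (R : fieldType) else (R[i] : fieldType).

Section Defs.
Variable K : fieldType.

(* sign (-1)^{|x||y|} for homogeneous elements of degrees i, j (parity = degree mod 2) *)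
Definition sgn (i j : int) : K :=
  if odd `|i|%N && odd `|j|%N then -1 else 1.

Definition is_subspace (A : lmodType K) (P : A -> Prop) : Prop :=
  [/\ P 0, (forall x y, P x -> P y -> P (x + y)) & (forall (c : K) x, P x -> P (c *: x))].

Definition lin (A C : lmodType K) (f : A -> C) : Prop :=
  forall (c : K) x y, f (c *: x + y) = c *: f x + f y.

Definition bilin (A C D : lmodType K) (br : A -> C -> D) : Prop :=
  (forall y, lin (fun x => br x y)) /\ (forall x, lin (br x)).

Definition LieAlg (g : lmodType K) (br : g -> g -> g) : Prop :=
  [/\ bilin br, (forall x, br x x = 0) &
      (forall x y z, br x (br y z) = br (br x y) z + br y (br x z))].

Definition LieModule (g : lmodType K) (br : g -> g -> g) (V : lmodType K)
  (act : g -> V -> V) : Prop :=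
  bilin act /\ (forall x y v, act (br x y) v = act x (act y v) - act y (act x v)).

Definition LieLeibnizTriple (g : lmodType K) (br : g -> g -> g) (V : lmodType K)
  (act : g -> V -> V) (Th : V -> g) : Prop :=
  [/\ LieAlg br, LieModule br act, lin Th &
      (forall u v, Th (act (Th u) v) = br (Th u) (Th v))].

Definition lie_ideal (g : lmodType K) (br : g -> g -> g) (I : g -> Prop) : Prop :=
  is_subspace I /\ (forall x y, I y -> I (br x y)).

Definition simpleLie (g : lmodType K) (br : g -> g -> g) : Prop :=
  (exists x y, br x y != 0) /\
  (forall I, lie_ideal br I -> (forall x, I x -> x = 0) \/ (forall x, I x)).

Definition faithful (g V : lmodType K) (act : g -> V -> V) : Prop :=
  forall x, (forall v, act x v = 0) -> x = 0.

(* A graded space is an ambient space A with subspaces D k (k : int) such that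
   A = (+)_k D k (direct sum). *)
Definition is_grading (A : lmodType K) (D : int -> A -> Prop) : Prop :=
  [/\ (forall k, is_subspace (D k)),
      (forall a, exists (s : seq int) (f : int -> A),
          (forall k, D k (f k)) /\ a = \sum_(k <- s) f k) &
      (forall (s : seq int) (f : int -> A), uniq s -> (forall k, D k (f k)) ->
          \sum_(k <- s) f k = 0 -> forall k, k \in s -> f k = 0)].

Definition LieSuper (A : lmodType K) (br : A -> A -> A) (D : int -> A -> Prop) : Prop :=
  [/\ is_grading D, bilin br,
      (forall i j x y, D i x -> D j y -> D (i + j) (br x y)),
      (forall i j x y, D i x -> D j y -> br x y = - (sgn i j *: br y x)) &
      (forall i j k x y z, D i x -> D j y -> D k z ->
          br x (br y z) = br (br x y) z + sgn i j *: br y (br x z))].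

Definition deg_ge (A : lmodType K) (D : int -> A -> Prop) (n : int) (x : A) : Prop :=
  exists (s : seq int) (f : int -> A),
    [/\ (forall k, D k (f k)), (forall k, k \in s -> n <= k) & x = \sum_(k <- s) f k].

Definition graded (A : lmodType K) (D : int -> A -> Prop) (P : A -> Prop) : Prop :=
  forall (s : seq int) (f : int -> A), uniq s -> (forall k, D k (f k)) ->
    P (\sum_(k <- s) f k) -> forall k, k \in s -> P (f k).

Definition subalg (A : lmodType K) (br : A -> A -> A) (D : int -> A -> Prop)
  (P : A -> Prop) : Prop :=
  [/\ is_subspace P, (forall x y, P x -> P y -> P (br x y)) & graded D P].

Definition gen_subalg (A : lmodType K) (br : A -> A -> A) (D : int -> A -> Prop)
  (G : A -> Prop) (x : A) : Prop :=
  forall P, subalg br D P -> (forall y, G y -> P y) -> P x.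

Definition ideal_of (A : lmodType K) (br : A -> A -> A) (D : int -> A -> Prop)
  (S M : A -> Prop) : Prop :=
  [/\ is_subspace M, (forall x, M x -> S x),
      (forall x y, S x -> M y -> M (br x y)) & graded D M].

Definition ad_bij (A : lmodType K) (br : A -> A -> A) (D : int -> A -> Prop) (k : int) : Prop :=
  (forall x, D k x -> (forall u, D 1 u -> br x u = 0) -> x = 0) /\
  (forall phi : A -> A, lin phi -> (forall u, D 1 u -> D (k + 1) (phi u)) ->
     exists x, D k x /\ (forall u, D 1 u -> br x u = phi u)).

(* A_+ = (+)_{k >= 1} D k is the free Lie superalgebra on D 1 (universal property
   among Z-graded Lie superalgebras, generators in degree 1) *)
Definition ext_hom (A : lmodType K) (br : A -> A -> A) (D : int -> A -> Prop)
  (C : lmodType K) (brC : C -> C -> C) (phi psi : A -> C) : Prop :=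
  [/\ lin psi, (forall u, D 1 u -> psi u = phi u) &
      (forall x y, deg_ge D 1 x -> deg_ge D 1 y -> psi (br x y) = brC (psi x) (psi y))].

Definition free_plus (A : lmodType K) (br : A -> A -> A) (D : int -> A -> Prop) : Prop :=
  forall (C : lmodType K) (brC : C -> C -> C) (DC : int -> C -> Prop),
    LieSuper brC DC ->
    forall phi : A -> C, lin phi -> (forall u, D 1 u -> DC 1 (phi u)) ->
      (exists psi, ext_hom br D brC phi psi) /\
      (forall psi1 psi2, ext_hom br D brC phi psi1 -> ext_hom br D brC phi psi2 ->
          forall x, deg_ge D 1 x -> psi1 x = psi2 x).

(* (A, br, D) together with ig : g -> A, iV : V -> A is the Lie superalgebra U(g,V)
   of the context: U_0 = g, U_1 = V[-1], U_{-p+1} = Hom(U_1, U_{-p+2}) (p >= 2),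
   bracket on U_{1-} as prescribed, U_+ free on U_1. *)
Definition is_bbU (g : lmodType K) (brg : g -> g -> g) (V : lmodType K)
  (act : g -> V -> V) (A : lmodType K) (br : A -> A -> A) (D : int -> A -> Prop)
  (ig : g -> A) (iV : V -> A) : Prop :=
  [/\ LieSuper br D, (lin ig /\ injective ig) /\ (lin iV /\ injective iV),
      (forall a, D 0 a <-> exists x, a = ig x) /\ (forall a, D 1 a <-> exists v, a = iV v),
      (forall x y, ig (brg x y) = br (ig x) (ig y)) /\
      (forall x v, br (ig x) (iV v) = iV (act x v)) &
      (forall k, k <= -1 -> ad_bij br D k) /\ free_plus br D].

(* (B, br, D) with iW : W -> B is the universal Lie superalgebra U associated to
   U_1 = W: U_0 = End(U_1), U_{-p+1} = Hom(U_1, U_{-p+2}), U_+ free on U_1. *)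
Definition is_univ (W : lmodType K) (B : lmodType K) (br : B -> B -> B)
  (D : int -> B -> Prop) (iW : W -> B) : Prop :=
  [/\ LieSuper br D, lin iW /\ injective iW,
      (forall b, D 1 b <-> exists w, b = iW w),
      (forall k, k <= 0 -> ad_bij br D k) & free_plus br D].

Section Lcons.
Variables (A : lmodType K) (br : A -> A -> A) (D : int -> A -> Prop).
Variables (theta : A) (sigma : A -> A).

Definition RTheta (x : A) : Prop :=
  forall M, is_subspace M -> (forall y, M y -> D (-1) y) -> M theta ->
    (forall a y, D 0 a -> M y -> M (br a y)) -> M x.

Definition Ssub : A -> Prop :=
  gen_subalg br D (fun y => RTheta y \/ D 0 y \/ D 1 y).

Definition Kmod (x : A) : Prop :=
  exists M, [/\ is_subspace M, (forall y, M y -> D 2 y),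
    (forall a y, D 0 a -> M y -> M (br a y)), (forall y, M y -> sigma y = 0) & M x].

Definition Kideal (x : A) : Prop :=
  forall M, ideal_of br D Ssub M -> (forall y, Kmod y -> M y) -> M x.

(* Lker: kernel of S -> T = S / Kideal -> L = T / J, where J is the sum of all
   ideals of T contained in T_{3+}; an ideal of T corresponds to an ideal of S
   containing Kideal, and T_{3+} is the image of S /\ A_{>=3}. *)
Definition Lker (x : A) : Prop :=
  exists M, [/\ ideal_of br D Ssub M, (forall y, Kideal y -> M y),
    (forall y, M y -> exists k z, [/\ Kideal k, Ssub z, deg_ge D 3 z & y = k + z]) & M x].
End Lcons.

Section Pcons.
Variables (B : lmodType K) (br : B -> B -> B) (D : int -> B -> Prop) (T : B -> Prop).

Definition Ptil : B -> Prop := gen_subalg br D (fun y => D 1 y \/ T y).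

(* I: the maximal ideal of Ptil meeting Ptil_{-1} + Ptil_0 + Ptil_1 trivially
   (= the union of all such ideals, which is again such an ideal) *)
Definition Pker (x : B) : Prop :=
  exists M, [/\ ideal_of br D Ptil M,
    (forall y, M y -> (exists a b c, [/\ D (-1) a, D 0 b, D 1 c & y = a + b + c]) -> y = 0)
    & M x].
End Pcons.

(* S/N and P/I are isomorphic as (graded) Lie superalgebras, expressed by a
   linear lift f : A -> B of the isomorphism. *)
Definition quot_iso (A B : lmodType K) (brA : A -> A -> A) (DA : int -> A -> Prop)
  (brB : B -> B -> B) (DB : int -> B -> Prop)
  (S N : A -> Prop) (P I : B -> Prop) : Prop :=
  exists f : A -> B,
    [/\ lin f /\ (forall k x, S x -> DA k x -> DB k (f x)),
        (forall x, S x -> P (f x)),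
        (forall x y, S x -> S y -> I (f (brA x y) - brB (f x) (f y))),
        (forall x, S x -> (I (f x) <-> N x)) &
        (forall y, P y -> exists x, S x /\ I (f x - y))].

End Defs.

(* Main.v *)
Require Import Defs.
From HB Require Import structures.
From mathcomp Require Import all_boot all_order all_algebra.
From mathcomp Require Import boolp reals.
From mathcomp Require Import zify.
From mathcomp.real_closed Require Import complex.
Import Order.TTheory GRing.Theory Num.Theory.
Local Open Scope ring_scope.
Set Implicit Arguments. Unset Strict Implicit. Unset Printing Implicit Defensive.

(* The faithful action identifies [bbU] with a subalgebra of [U] in degrees at most 1: there
   is a morphism [F : bbU -> U] extending [U_1 = W], defined in nonpositive degrees by
   [[F x, u] = F [x, u]] and in positive degrees by freeness, and it is injective in degrees
   at most 1. Put [T = F(R_Theta)]. The subspace [[R_Theta, U_1]] of [g] is a nonzero ideal,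
   hence all of [g], so [F] maps [S] onto the subalgebra generated by [U_1] and [T].
   On [U_2 = [U_1, U_1]] the map [sigma] is [1/2 ad Theta], so that [K] is the annihilator of
   [R_Theta] in [U_2]. An ideal of [P~] meeting the local part trivially vanishes in degrees
   at most 1 by transitivity, and its preimage in degree 2 is annihilated by [R_Theta], that
   is, contained in [K]; conversely, the ideal generated by [K] lives in degrees at least 2.
   Hence [F] matches the two kernels. *)

(** * Linear maps, and subspaces given by predicates *)

Section LinearMaps.
Variables (K : fieldType) (A C : lmodType K) (f : A -> C).
Hypothesis lin_f : lin f.

Lemma linD x y : f (x + y) = f x + f y.
Proof. by have := lin_f 1 x y; rewrite !scale1r. Qed.

Lemma lin0 : f 0 = 0.
Proof. by apply: (addrI (f 0)); rewrite -linD !addr0. Qed.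

Lemma linZ c x : f (c *: x) = c *: f x.
Proof. by have := lin_f c x 0; rewrite lin0 !addr0. Qed.

Lemma linN x : f (- x) = - f x.
Proof. by rewrite -scaleN1r linZ scaleN1r. Qed.

Lemma linB x y : f (x - y) = f x - f y.
Proof. by rewrite linD linN. Qed.

Lemma lin_sum (I : Type) (s : seq I) (h : I -> A) :
  f (\sum_(k <- s) h k) = \sum_(k <- s) f (h k).
Proof. exact: (big_morph f linD lin0). Qed.

End LinearMaps.

Lemma lin_comp (K : fieldType) (A B C : lmodType K) (f : B -> C) (h : A -> B) :
  lin f -> lin h -> lin (fun x => f (h x)).
Proof. by move=> lf lh c x y; rewrite lh lf. Qed.

Section Subspaces.
Variables (K : fieldType) (A : lmodType K).
Implicit Types (P Q G : A -> Prop).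

Lemma subspN P x : is_subspace P -> P x -> P (- x).
Proof. by case=> _ _ PZ Px; rewrite -scaleN1r; apply: PZ. Qed.

Lemma subspB P x y : is_subspace P -> P x -> P y -> P (x - y).
Proof. by move=> sP Px Py; case: (sP) => _ PD _; apply: PD => //; apply: subspN. Qed.

Lemma subsp_sum P (I : eqType) (s : seq I) (f : I -> A) :
  is_subspace P -> (forall k, k \in s -> P (f k)) -> P (\sum_(k <- s) f k).
Proof.
case=> P0 PD _ Pf; rewrite big_seq_cond; apply: big_ind => // k /andP[ks _].
exact: Pf.
Qed.

Lemma subsp_preim (C : lmodType K) (f : C -> A) P :
  lin f -> is_subspace P -> is_subspace (fun x => P (f x)).
Proof.
move=> lf [P0 PD PZ]; split; first by rewrite (lin0 lf).
- by move=> x y Px Py; rewrite (linD lf); apply: PD.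
- by move=> c x Px; rewrite (linZ lf); apply: PZ.
Qed.

Lemma subsp_im (C : lmodType K) (f : A -> C) P :
  lin f -> is_subspace P -> is_subspace (fun y => exists x, P x /\ f x = y).
Proof.
move=> lf [P0 PD PZ]; split; first by exists 0; rewrite (lin0 lf).
- move=> _ _ [x [Px <-]] [y [Py <-]].
  by exists (x + y); rewrite (linD lf); split=> //; apply: PD.
- by move=> c _ [x [Px <-]]; exists (c *: x); rewrite (linZ lf); split=> //; apply: PZ.
Qed.

Lemma subsp_zero : is_subspace (fun x : A => x = 0).
Proof. by split=> [//|x y -> ->|c x ->]; rewrite ?addr0 ?scaler0. Qed.

Lemma subspI P Q : is_subspace P -> is_subspace Q -> is_subspace (fun x => P x /\ Q x).
Proof.
case=> P0 PD PZ [Q0 QD QZ]; split=> // [x y [Px Qx] [Py Qy]|c x [Px Qx]].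
  by split; [apply: PD | apply: QD].
by split; [apply: PZ | apply: QZ].
Qed.

Lemma subsp_all (I : Type) (R : I -> Prop) (P : I -> A -> Prop) :
  (forall i, R i -> is_subspace (P i)) -> is_subspace (fun x => forall i, R i -> P i x).
Proof.
move=> sP; split=> [i Ri|x y Px Py i Ri|c x Px i Ri]; have [P0 PD PZ] := sP i Ri => //.
  by apply: PD; [apply: Px | apply: Py].
by apply: PZ; apply: Px.
Qed.

(** Encoded as an intersection, so that a membership proof is itself the induction principle on
    generators. *)
Definition span G (x : A) : Prop :=
  forall P, is_subspace P -> (forall y, G y -> P y) -> P x.

Lemma span_subspace G : is_subspace (span G).
Proof.
split=> [P [] //|x y Gx Gy P sP PG|c x Gx P sP PG]; case: (sP) => _ PD PZ.
  by apply: PD; [apply: Gx | apply: Gy].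
by apply: PZ; apply: Gx.
Qed.

Lemma span_gen G x : G x -> span G x.
Proof. by move=> Gx P _; apply. Qed.

End Subspaces.

Section SubspaceType.
Variables (K : fieldType) (A : lmodType K) (P : A -> Prop).
Hypothesis sP : is_subspace P.

Let p : {pred A} := fun x => `[< P x >].

Let p_submod : GRing.submod_closed p.
Proof.
case: sP => P0 PD PZ; split; first exact/asboolP.
by move=> c x y /asboolP Px /asboolP Py; apply/asboolP; apply: PD => //; apply: PZ.
Qed.

HB.instance Definition _ :=
  GRing.isSubmodClosed.Build K A p (GRing.submod_closed_semi p_submod).

Let T := {x : A | x \in p}.
HB.instance Definition _ := SubChoice.on T.
HB.instance Definition _ := [SubChoice_isSubLmodule of T by <:].

(** The universal property in [free_plus] quantifies over module types, so a subspace has to be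
    realised as such a type before it can serve as a target. *)
Lemma subspace_lmod :
  exists (C : lmodType K) (i : C -> A),
    [/\ lin i, injective i, (forall c, P (i c)) & (forall x, P x -> exists c, i c = x)].
Proof.
exists T, val; split=> // [|c|x Px].
- exact: val_inj.
- exact/asboolP/(valP c).
- by have px : x \in p by [exact/asboolP]; exists (exist _ x px).
Qed.

End SubspaceType.

(** * Graded spaces and homogeneous components *)

Lemma big_widen (V : nmodType) (I : eqType) (s t : seq I) (f : I -> V) :
  uniq s -> uniq t -> {subset s <= t} -> (forall k, k \notin s -> f k = 0) ->
  \sum_(k <- t) f k = \sum_(k <- s) f k.
Proof.
move=> us ut st f0; rewrite (bigID (mem s)) /= [X in _ + X]big1 ?addr0 //.
rewrite -big_filter; apply/perm_big/uniq_perm => [||k]; rewrite ?filter_uniq //.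
by rewrite mem_filter; case: (boolP (k \in s)) => //= /st.
Qed.

Section Gradings.
Variables (K : fieldType) (A : lmodType K) (D : int -> A -> Prop).
Hypothesis grD : is_grading D.

Lemma grading_subspace k : is_subspace (D k).
Proof. by case: grD. Qed.

(** The list in [is_grading] may repeat indices; terms of equal index are collected, which gives a
    family vanishing off a duplicate-free list. *)
Lemma grading_decomp x : exists f : int -> A,
  (forall k, D k (f k)) /\
  exists s, [/\ uniq s, (forall k, k \notin s -> f k = 0) & x = \sum_(k <- s) f k].
Proof.
have [_ /(_ x)[s [f [Df ->]]] _] := grD.
exists (fun j => \sum_(k <- s | k == j) f k); split=> [j|].
  have [D0 DD _] := grading_subspace j.
  by apply: big_ind => // k /eqP <-.
exists (undup s); split=> [|j|]; first exact: undup_uniq.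
  rewrite mem_undup => js; rewrite big_seq_cond big1 // => k /andP[ks /eqP kj].
  by rewrite -kj ks in js.
rewrite (exchange_big_dep xpredT) //= [LHS]big_seq [RHS]big_seq; apply: eq_bigr => k ks.
rewrite big_mkcond (bigD1_seq k) ?mem_undup ?undup_uniq //= eqxx big1 ?addr0 // => j.
by rewrite eq_sym => /negbTE ->.
Qed.

Definition comp (k : int) (x : A) : A := sval (cid (grading_decomp x)) k.

Lemma comp_deg k x : D k (comp k x).
Proof. by rewrite /comp; case: cid => f /= []. Qed.

Lemma comp_sum x : exists s, [/\ uniq s, (forall k, k \notin s -> comp k x = 0) &
  x = \sum_(k <- s) comp k x].
Proof. by rewrite /comp; case: cid => f /= []. Qed.

(** Both families are summed over the union of their supports, where directness applies to the
    difference. *)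
Lemma comp_unique (s : seq int) (f : int -> A) x : uniq s -> (forall k, D k (f k)) ->
  (forall k, k \notin s -> f k = 0) -> x = \sum_(k <- s) f k -> forall k, comp k x = f k.
Proof.
move=> us Df f0 xE k; have [t [ut t0 xE']] := comp_sum x.
set r := undup (s ++ t).
have ur : uniq r by rewrite undup_uniq.
have sr : {subset s <= r} by move=> j; rewrite mem_undup mem_cat => ->.
have tr : {subset t <= r} by move=> j; rewrite mem_undup mem_cat => ->; rewrite orbT.
have [kr|] := boolP (k \in r); last first.
  by rewrite mem_undup mem_cat negb_or => /andP[/f0 -> /t0 ->].
apply/eqP; rewrite -subr_eq0; apply/eqP.
case: grD => _ _ /(_ r (fun j => comp j x - f j) ur) /(_ _ _ k kr); apply=> [j|].
  by apply: (subspB (grading_subspace j)) => //; apply: comp_deg.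
by rewrite sumrB (big_widen us ur sr f0) (big_widen ut ur tr t0) -xE -xE' subrr.
Qed.

Lemma comp_id k x : D k x -> comp k x = x.
Proof.
move=> Dx; pose f j : A := if j == k then x else 0.
have fE : f k = x by rewrite /f eqxx.
rewrite -[RHS]fE; apply: (@comp_unique [:: k] f) => // [j|j|]; rewrite ?/f.
- by case: eqP => [->//|_]; case: (grading_subspace j).
- by rewrite inE => /negbTE ->.
- by rewrite big_seq1 eqxx.
Qed.

Lemma comp_neq0 j k x : D j x -> k != j -> comp k x = 0.
Proof.
move=> Dx kj; pose f i : A := if i == j then x else 0.
have fE : f k = 0 by rewrite /f (negbTE kj).
rewrite -[RHS]fE; apply: (@comp_unique [:: j] f) => // [i|i|]; rewrite ?/f.
- by case: eqP => [->//|_]; case: (grading_subspace i).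
- by rewrite inE => /negbTE ->.
- by rewrite big_seq1 eqxx.
Qed.

Lemma comp_lin k : lin (comp k).
Proof.
move=> c x y; have [s [us s0 xE]] := comp_sum x; have [t [ut t0 yE]] := comp_sum y.
set r := undup (s ++ t).
have ur : uniq r by rewrite undup_uniq.
have sr : {subset s <= r} by move=> j; rewrite mem_undup mem_cat => ->.
have tr : {subset t <= r} by move=> j; rewrite mem_undup mem_cat => ->; rewrite orbT.
apply: (@comp_unique r (fun k => c *: comp k x + comp k y)) => // [j|j|].
- case: (grading_subspace j) => _ DD DZ.
  by apply: DD; [apply: DZ|]; apply: comp_deg.
- rewrite mem_undup mem_cat negb_or => /andP[/s0 -> /t0 ->].
  by rewrite scaler0 addr0.
- rewrite big_split /= -scaler_sumr.
  by rewrite (big_widen us ur sr s0) (big_widen ut ur tr t0) -xE -yE.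
Qed.

Lemma comp_comp j k x : comp j (comp k x) = if j == k then comp k x else 0.
Proof.
case: eqP => [->|/eqP jk]; first by rewrite comp_id //; apply: comp_deg.
exact: comp_neq0 (comp_deg k x) jk.
Qed.

Lemma comp_eq x y : (forall k, comp k x = comp k y) -> x = y.
Proof.
move=> xy; have [s [us s0 xE]] := comp_sum (x - y).
apply/eqP; rewrite -subr_eq0 xE big1_seq // => k _.
by rewrite (linB (@comp_lin k)) xy subrr.
Qed.

Lemma grading_ind (P : A -> Prop) : is_subspace P -> (forall k x, D k x -> P x) ->
  forall x, P x.
Proof.
move=> sP PD x; have [s [_ _ ->]] := comp_sum x.
by apply: subsp_sum => // k _; apply: PD (comp_deg k x).
Qed.

Lemma gradedP (P : A -> Prop) : is_subspace P ->
  graded D P <-> (forall k x, P x -> P (comp k x)).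
Proof.
move=> sP; split=> [gP k x Px | Pc s f us Df Pf k ks].
  have [s [us s0 xE]] := comp_sum x.
  have [ks|/s0 ->] := boolP (k \in s); last by case: sP.
  apply: (gP s (comp^~ x)) => // [j|]; first exact: comp_deg.
  by rewrite -xE.
suff -> : f k = comp k (\sum_(k <- s) f k) by apply: Pc.
rewrite (lin_sum (@comp_lin k)) (bigD1_seq k) //= comp_id // big1 ?addr0 // => j jk.
by apply: comp_neq0 (Df j) _; rewrite eq_sym.
Qed.

Lemma deg_geP n x : deg_ge D n x <-> (forall k, k < n -> comp k x = 0).
Proof.
split=> [[s [f [Df sn ->]]] k kn | x0].
  rewrite (lin_sum (@comp_lin k)) big1_seq // => j /= /sn nj.
  by apply: comp_neq0 (Df j) _; apply: contraTneq kn => ->; rewrite -leNgt.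
have [s [us s0 xE]] := comp_sum x.
exists [seq k <- s | n <= k], (comp^~ x); split=> [k|k|]; first exact: comp_deg.
  by rewrite mem_filter => /andP[].
rewrite {1}xE big_filter [LHS](bigID (fun k => n <= k)) /= [X in _ + X]big1 ?addr0 // => k.
by rewrite -ltNge => /x0.
Qed.

Lemma deg_ge_D n k x : n <= k -> D k x -> deg_ge D n x.
Proof.
move=> nk Dx; apply/deg_geP => j jn; apply: comp_neq0 Dx _.
by rewrite lt_eqF // (lt_le_trans jn).
Qed.

(** A linear map may be prescribed degree by degree: apply each [F k] to the component of degree [k]
    and sum. *)
Lemma glue_lin (C : lmodType K) (F : int -> A -> C) : (forall k, lin (F k)) ->
  exists f, lin f /\ forall k x, D k x -> f x = F k x.
Proof.
move=> lF; pose supp x := sval (cid (comp_sum x)).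
have suppP x : [/\ uniq (supp x), (forall k, k \notin supp x -> comp k x = 0) &
    x = \sum_(k <- supp x) comp k x] by rewrite /supp; case: cid.
pose f x := \sum_(k <- supp x) F k (comp k x).
(* Any list covering the support gives the same value, so two arguments can be treated over a common
   list. *)
have fE (t : seq int) x : uniq t -> (forall k, k \notin t -> comp k x = 0) ->
    f x = \sum_(k <- t) F k (comp k x).
  move=> ut t0; have [us s0 _] := suppP x; set r := undup (supp x ++ t).
  have f0 (s : seq int) : (forall k, k \notin s -> comp k x = 0) ->
      forall k, k \notin s -> F k (comp k x) = 0.
    by move=> cs k /cs ->; rewrite (lin0 (lF k)).
  transitivity (\sum_(k <- r) F k (comp k x)); [symmetry|]; apply: big_widen.
  - by [].
  - exact: undup_uniq.
  - by move=> k kx; rewrite mem_undup mem_cat kx.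
  - exact: f0.
  - by [].
  - exact: undup_uniq.
  - by move=> k kt; rewrite mem_undup mem_cat kt orbT.
  - exact: f0.
exists f; split=> [c x y|k x Dx].
  have [us s0 _] := suppP x; have [ut t0 _] := suppP y.
  rewrite !(fE (undup (supp x ++ supp y))) ?undup_uniq // => [|k|k|k].
  - by rewrite scaler_sumr -big_split /=; apply: eq_bigr => k _; rewrite comp_lin lF.
  - by rewrite mem_undup mem_cat negb_or => /andP[_ /t0].
  - by rewrite mem_undup mem_cat negb_or => /andP[/s0].
  - rewrite mem_undup mem_cat negb_or => /andP[/s0 x0 /t0 y0].
    by rewrite comp_lin x0 y0 scaler0 addr0.
rewrite (fE [:: k]) // ?big_seq1 ?comp_id // => j; rewrite inE => jk.
exact: comp_neq0 Dx jk.
Qed.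

End Gradings.

(** * Lie superalgebras: generated subalgebras and the free positive part *)

Section LieSuperalgebras.
Variables (K : fieldType) (A : lmodType K) (br : A -> A -> A) (D : int -> A -> Prop).
Hypothesis LA : LieSuper br D.

Lemma LS_grading : is_grading D. Proof. by case: LA. Qed.
Let gr := LS_grading.

Lemma br_linl y : lin (br^~ y). Proof. by case: LA => _ []. Qed.
Lemma br_linr x : lin (br x). Proof. by case: LA => _ []. Qed.
Lemma br0r x : br x 0 = 0. Proof. exact: lin0 (br_linr x). Qed.
Lemma br0l x : br 0 x = 0. Proof. exact: lin0 (br_linl x). Qed.

Lemma br_deg i j k x y : D i x -> D j y -> i + j = k -> D k (br x y).
Proof. by move=> Dx Dy <-; case: LA => _ _ dg _ _; apply: dg. Qed.

Lemma br_anti i j x y : D i x -> D j y -> br x y = - (sgn K i j *: br y x).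
Proof. by case: LA => _ _ _ + _; apply. Qed.

(** The identity is linear in [z], and its sign depends only on the degrees of [x] and [y]; hence
    [z] may be arbitrary. *)
Lemma br_jacobi i j x y z : D i x -> D j y ->
  br x (br y z) = br (br x y) z + sgn K i j *: br y (br x z).
Proof.
move=> Dx Dy; pose P z :=
  br x (br y z) - (br (br x y) z + sgn K i j *: br y (br x z)) = 0.
suff : P z by move/eqP; rewrite subr_eq0 => /eqP.
apply: (grading_ind gr) z => [|k z Dz]; last first.
  by case: LA => _ _ _ _ jac; rewrite /P (jac _ _ _ _ _ _ Dx Dy Dz) subrr.
apply: subsp_preim (subsp_zero _) => c z w.
rewrite (br_linr y) !(br_linr x) (br_linr (br x y)) (br_linr y) scalerDr.
rewrite scalerA (mulrC (sgn K i j)) -scalerA.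
by rewrite addrACA -scalerDr opprD addrACA -scalerN -scalerDr.
Qed.

Lemma br_jacobi_l i j x y z : D i x -> D j y ->
  br (br x y) z = br x (br y z) - sgn K i j *: br y (br x z).
Proof. by move=> Dx Dy; rewrite (br_jacobi _ Dx Dy) addrK. Qed.

Lemma subalg_gen (G : A -> Prop) : subalg br D (gen_subalg br D G).
Proof.
split.
- split=> [P [[]] //|x y Gx Gy P aP PG|c x Gx P aP PG]; case: (aP) => -[_ PD PZ] _ _.
    by apply: PD; [apply: Gx | apply: Gy].
  by apply: PZ; apply: Gx.
- move=> x y Gx Gy P aP PG; case: (aP) => _ Pbr _.
  by apply: Pbr; [apply: Gx | apply: Gy].
- move=> s f us Df Gf k ks P aP PG; case: (aP) => _ _ gP.
  by apply: gP us Df (Gf P aP PG) k ks.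
Qed.

Lemma gen_subalg_gen (G : A -> Prop) x : G x -> gen_subalg br D G x.
Proof. by move=> Gx P _; apply. Qed.

Lemma subalg_comp (P : A -> Prop) k x : subalg br D P -> P x -> P (comp gr k x).
Proof. by case=> sP _ /(gradedP gr sP); apply. Qed.

(* The inclusion of [P] and the extension to [P] of the identity of [D 1] compose to the
   identity of the free part. *)
Lemma free_plus_generated (P : A -> Prop) : free_plus br D -> subalg br D P ->
  (forall u, D 1 u -> P u) -> forall x, deg_ge D 1 x -> P x.
Proof.
move=> fA aP P1 x x1; have [sP Pbr gP] := aP.
have [C [i [li inji Pi surji]]] := subspace_lmod sP.
(* [r] is chosen pointwise, with the default 0 off [P]. *)
have /choice[r rK] : forall x, exists c, P x -> i c = x.
  by move=> y; have [/surji[c]|nP] := pselect (P y); [exists c|exists 0].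
have bP a b : P (br (i a) (i b)) by apply: Pbr.
pose DC k c := D k (i c); pose brC a b := r (br (i a) (i b)).
have ibr a b : i (brC a b) = br (i a) (i b) by rewrite /brC rK.
(* Each axiom is checked after applying the injective [i], where it becomes the axiom in [A]. *)
have LC : LieSuper brC DC.
  split.
  - split=> [k|c|s f us Df f0 k ks].
    + exact: subsp_preim li (grading_subspace gr k).
    + have [s [us s0 cE]] := comp_sum gr (i c).
      have Pc k : P (comp gr k (i c)) by apply: subalg_comp aP _.
      exists s, (fun k => r (comp gr k (i c))); split=> [k|].
        by rewrite /DC rK //; apply: comp_deg.
      by apply: inji; rewrite (lin_sum li) {1}cE; apply: eq_bigr => k _; rewrite rK.
    + apply: inji; rewrite (lin0 li); case: gr => _ _ dir.
      by apply: (dir s (fun k => i (f k))) ks => //; rewrite -(lin_sum li) f0 (lin0 li).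
  - split=> [c k a b|a k c b]; apply: inji; rewrite li !ibr li.
      exact: br_linl.
    exact: br_linr.
  - by move=> j k a b Da Db; rewrite /DC ibr; apply: br_deg Da Db _.
  - move=> j k a b Da Db; apply: inji; rewrite (linN li) (linZ li) !ibr.
    exact: br_anti.
  - move=> j k l a b c Da Db _; apply: inji; rewrite (linD li) (linZ li) !ibr.
    exact: br_jacobi.
(* Projecting to degree 1 keeps the argument of [r] inside [P], where [r] inverts [i] and is
   therefore linear. *)
have lr : lin (fun y => r (comp gr 1 y)).
  have Pc y : P (comp gr 1 y) by apply: P1; apply: comp_deg.
  by move=> c y z; apply: inji; rewrite li !rK //; apply: comp_lin.
have r1 u : D 1 u -> i (r (comp gr 1 u)) = u.
  by move=> Du; rewrite comp_id // rK //; apply: P1.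
have [//|[psi [lpsi psi1 psibr]] _] := fA C brC DC LC _ lr.
  by move=> u Du; rewrite /DC r1.
have [//|//|_ uniqA] := fA A br D LA id.
suff <- : i (psi x) = x by apply: Pi.
apply: (uniqA (fun x => i (psi x)) id) => //; split=> // [|u Du|y z y1 z1].
- exact: lin_comp.
- by rewrite psi1 // r1.
- by rewrite psibr // ibr.
Qed.

(** Span of the nested brackets [u_0, [u_1, ..., u_n]] with entries in [D 1]; index [n] stands for
    degree [n + 1]. *)
Fixpoint lnormed (n : nat) : A -> Prop :=
  if n is m.+1 then span (fun y => exists u x, [/\ D 1 u, lnormed m x & y = br u x])
  else D 1.

Lemma lnormed_subspace n : is_subspace (lnormed n).
Proof. by case: n => [|n]; [apply: grading_subspace | apply: span_subspace]. Qed.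

Lemma lnormed_deg n x : lnormed n x -> D n.+1 x.
Proof.
elim: n x => [//|n IH] x /(_ (D n.+2)); apply=> [|_ [u [y [Du /IH Dy ->]]]]; first exact: grading_subspace.
by apply: br_deg Du Dy _; lia.
Qed.

(** Jacobi strips the outer entry [u] off the left factor, giving [u, [x, y]] and [x, [u, y]]; [n]
    varies in the induction because the latter lengthens [y]. *)
Lemma lnormed_br m n x y : lnormed m x -> lnormed n y -> lnormed (m + n).+1 (br x y).
Proof.
elim: m n x y => [|m IH] n x y Lx Ly; first by apply: span_gen; exists x, y.
move: Lx => /(_ (fun x => lnormed (m.+1 + n).+1 (br x y))).
apply=> [|{x} _ [u [x [Du Lx ->]]]].
  exact: subsp_preim (br_linl y) (lnormed_subspace _).
rewrite (br_jacobi_l y Du (lnormed_deg Lx)).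
have [_ _ LZ] := lnormed_subspace (m.+1 + n).+1.
apply: subspB (lnormed_subspace _) _ (LZ _ _ _).
  by apply: span_gen; exists u, (br x y); split=> //; apply: IH.
by rewrite addSnnS; apply: IH => //; apply: span_gen; exists u, y.
Qed.

(** The sums of nested brackets form a graded subalgebra containing [D 1], so [free_plus_generated]
    applies. *)
Lemma free_plus_lnormed n x : free_plus br D -> D n.+1 x -> lnormed n x.
Proof.
move=> fA Dx.
(* Vanishing in nonpositive degrees makes each element of [P] a finite sum of nested brackets. The
   premise [True] only fits the shape of [subsp_all]. *)
pose P x := (forall k, k <= 0 -> comp gr k x = 0) /\
            (forall n, True -> lnormed n (comp gr n.+1 x)).
have sP : is_subspace P.
  apply: subspI; apply: subsp_all => k _.
    exact: subsp_preim (comp_lin gr k) (@subsp_zero _ _).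
  exact: subsp_preim (comp_lin gr _) (lnormed_subspace _).
have PL m y : lnormed m y -> P y.
  move=> Ly; have Dy := lnormed_deg Ly; split=> [k k0|k _].
    by apply: comp_neq0 Dy _; lia.
  have [->|km] := eqVneq k m; first by rewrite comp_id.
  by rewrite (comp_neq0 gr Dy); [case: (lnormed_subspace k) | lia].
have Pdec y : P y -> exists s : seq nat, exists f,
    (forall n, lnormed n (f n)) /\ y = \sum_(n <- s) f n.
  case=> y0 yL; have [s [us s0 yE]] := comp_sum gr y.
  exists [seq `|k|.-1 | k <- s & 0 < k], (fun n => comp gr n.+1 y); split=> [m|].
    exact: yL.
  rewrite {1}yE (bigID (fun k => 0 < k)) /= [X in _ + X]big1 ?addr0; last first.
    by move=> k; rewrite -leNgt => /y0.
  rewrite big_map big_filter; apply: eq_bigr => k k0; congr (comp gr _ y); lia.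
have aP : subalg br D P.
  split=> // [y z /Pdec[s [f [Lf ->]]] /Pdec[t [h [Lh ->]]]|].
    rewrite (lin_sum (br_linl _)); apply: subsp_sum => // j _.
    rewrite (lin_sum (br_linr _)); apply: subsp_sum => // k _.
    exact: PL (lnormed_br (Lf j) (Lh k)).
  apply/(gradedP gr sP) => k y [y0 yL].
  have [k0|k0] := leP k 0; first by rewrite y0 //; case: sP.
  have -> : k = `|k|.-1.+1 by lia.
  exact: PL (yL _ I).
have [_ /(_ n I)] : P x; last by rewrite comp_id.
apply: (free_plus_generated fA aP) => [u Du|]; first exact: (PL 0).
by apply: (deg_ge_D gr _ Dx); lia.
Qed.

(** The induction principle of the free part: degree [n + 2] is spanned by brackets of degree 1 with
    degree [n + 1]. *)
Lemma free_plus_ind (P : A -> Prop) n : free_plus br D -> is_subspace P ->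
  (forall u x, D 1 u -> D n.+1 x -> P (br u x)) -> forall x, D n.+2 x -> P x.
Proof.
move=> fA sP PU x /(free_plus_lnormed fA) /(_ P); apply=> // _ [u [y [Du Ly ->]]].
exact/PU/lnormed_deg.
Qed.

End LieSuperalgebras.

(** * Extending a map in degree 1 to a morphism *)

Section Extension.
Variables (K : fieldType) (A B : lmodType K).
Variables (brA : A -> A -> A) (DA : int -> A -> Prop).
Variables (brB : B -> B -> B) (DB : int -> B -> Prop).
Hypotheses (LA : LieSuper brA DA) (LB : LieSuper brB DB).
Hypothesis adB : forall k, k <= 0 -> ad_bij brB DB k.
Hypothesis freeA : free_plus brA DA.
Variables (e : A -> B) (e' : B -> A).
Hypotheses (lin_e : lin e) (lin_e' : lin e').
Hypotheses (e1 : forall u, DA 1 u -> DB 1 (e u)) (e'1 : forall w, DB 1 w -> DA 1 (e' w)).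
Hypothesis e'K : forall w, DB 1 w -> e (e' w) = w.
Hypothesis eK : forall u, DA 1 u -> e' (e u) = u.

Let grA := LS_grading LA.
Let grB := LS_grading LB.

(** One step downwards: [h] in degree [k] is tied to [h'] in degree [k + 1] by [h x, e u] = h'
    [x, u]. *)
Definition prolongs (k : int) (h' h : A -> B) : Prop :=
  [/\ lin h, (forall x, DA k x -> DB k (h x)) &
      (forall x u, DA k x -> DA 1 u -> brB (h x) (e u) = h' (brA x u))].

(** Surjectivity in [ad_bij] represents the map sending [w] to h' [x, e' w] by an element of [B];
    injectivity makes that element linear in [x]. *)
Lemma ex_prolongs k h' : k <= 0 -> lin h' ->
  (forall x, DA (k + 1) x -> DB (k + 1) (h' x)) -> exists h, prolongs k h' h.
Proof.
move=> k0 lh' h'deg; have [inj_ad surj_ad] := adB k0.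
have /choice[h hP] : forall x, exists y, DB k y /\
    forall w, DB 1 w -> brB y w = h' (brA (comp grA k x) (e' w)).
  move=> x; apply: surj_ad => [|w Dw].
    exact: lin_comp lh' (lin_comp (br_linr LA _) lin_e').
  by apply: h'deg; apply: (br_deg LA (comp_deg grA k x) (e'1 Dw)).
have hD x : DB k (h x) by case: (hP x).
have hbr x w : DB 1 w -> brB (h x) w = h' (brA (comp grA k x) (e' w)).
  by case: (hP x) => _; apply.
exists h; split=> [c x y|x _|x u Dx Du]; first last.
- by rewrite hbr ?eK ?comp_id //; apply: e1.
- exact: hD.
have [_ BD BZ] := grading_subspace grB k.
apply/eqP; rewrite -subr_eq0; apply/eqP/inj_ad => [|w Dw].
  by apply: (subspB (grading_subspace grB k)) => //; apply: BD => //; apply: BZ.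
rewrite (linB (br_linl LB w)) (br_linl LB w) !hbr // (comp_lin grA k).
by rewrite (br_linl LA) lh' subrr.
Qed.

(** Positive degrees come from freeness of [A]; degrees 0, -1, ... are reached by iterating
    [ex_prolongs] from [e]. *)
Lemma ex_extension : exists F : A -> B,
  [/\ lin F, (forall k x, DA k x -> DB k (F x)), (forall u, DA 1 u -> F u = e u) &
      (forall k x u, DA k x -> DA 1 u -> F (brA x u) = brB (F x) (F u))].
Proof.
have [[psi [lpsi psi1 psibr]] _] := freeA LB lin_e e1.
have psideg n x : DA n.+1 x -> DB n.+1 (psi x).
  elim: n x => [|n IH] x; first by move=> Dx; rewrite psi1 //; apply: e1.
  apply: (free_plus_ind LA freeA (subsp_preim lpsi (grading_subspace grB _))).
  move=> u y Du Dy; rewrite psibr; [|exact: (deg_ge_D grA)|exact: (deg_ge_D grA _ Dy)].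
  by apply: (br_deg LB) (IH _ Dy) _ => [|/=]; [rewrite psi1 //; apply: e1 | lia].
(* The hypotheses on the map are premises, and [h'] is the default when they fail, so the recursion
   [H] can be defined before its properties are proved. *)
have /choice[p pP] : forall nh : nat * (A -> B), exists h,
    lin nh.2 -> (forall x, DA (- nh.1%:Z + 1) x -> DB (- nh.1%:Z + 1) (nh.2 x)) ->
    prolongs (- nh.1%:Z) nh.2 h.
  move=> [n h'] /=.
  have [Hh|nH] := pselect (lin h' /\ forall x, DA (- n%:Z + 1) x -> DB (- n%:Z + 1) (h' x)).
    case: Hh => lh' h'deg; have [|h ph] := @ex_prolongs (- n%:Z) h' _ lh' h'deg; first by lia.
    by exists h.
  by exists h' => lh' h'deg; case: nH.
(* [H n] serves degree [1 - n]. *)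
pose H := fix H n := if n is m.+1 then p (m, H m) else e.
have HP n : lin (H n) /\ forall x, DA (1 - n%:Z) x -> DB (1 - n%:Z) (H n x).
  elim: n => [|n [lH degH]] /=; first by rewrite subr0.
  have nE : - n%:Z + 1 = 1 - n%:Z by lia.
  have [||lp degp _] := pP (n, H n) => //=; first by rewrite nE.
  by have -> : 1 - n.+1%:Z = - n%:Z by lia.
have HS n : prolongs (- n%:Z) (H n) (H n.+1).
  have [lH degH] := HP n; apply: (pP (n, H n)) => //=.
  by have -> : - n%:Z + 1 = 1 - n%:Z by lia.
pose Fk (k : int) := if k <= 1 then H (absz (1 - k)%R) else psi.
have [|F [lF FE]] := @glue_lin _ _ _ grA B Fk.
  by move=> k; rewrite /Fk; case: ifP => // _; case: (HP (absz (1 - k)%R)).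
have F1 u : DA 1 u -> F u = e u by move=> Du; rewrite (FE 1).
exists F; split=> // [k x Dx|k x u Dx Du].
  rewrite (FE k) // /Fk; case: ifPn => k1.
    have [_ degH] := HP (absz (1 - k)%R); have kE : k = 1 - (absz (1 - k)%R)%:Z by lia.
    by move: (degH x); rewrite -kE; apply.
  by have kE : k = `|k|.-1.+1 by [lia]; move: (@psideg `|k|.-1 x); rewrite -kE; apply.
rewrite (F1 u) // (FE k x) // (FE (k + 1) (brA x u)); last exact: (br_deg LA Dx Du erefl).
(* For [k >= 1] the claim is multiplicativity of [psi]; for [k <= 0] it is the defining equation of
   the prolongation. *)
rewrite /Fk; have [k1|k1] := leP k 1; last first.
  have -> : (k + 1 <= 1) = false by lia.
  rewrite psibr ?(psi1 u) //; last exact: (deg_ge_D grA _ Du).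
  by apply: (deg_ge_D grA _ Dx); lia.
have [kE|k0] := eqVneq k 1.
  rewrite kE /= in Dx *.
  rewrite psibr ?psi1 //; exact: (deg_ge_D grA).
have [n nE] : exists n : nat, k = - n%:Z by exists `|k|%N; lia.
have -> : (k + 1 <= 1) by lia.
have -> : absz (1 - k)%R = n.+1 by lia.
have -> : absz (1 - (k + 1))%R = n by lia.
by symmetry; case: (HS n) => _ _; apply; rewrite -?nE.
Qed.

Section Morphism.
Variable F : A -> B.
Hypothesis linF : lin F.
Hypothesis Fdeg : forall k x, DA k x -> DB k (F x).
Hypothesis F1 : forall u, DA 1 u -> F u = e u.
Hypothesis Fbr1 : forall k x u, DA k x -> DA 1 u -> F (brA x u) = brB (F x) (F u).

Let hom i j := forall x y, DA i x -> DA j y -> F (brA x y) = brB (F x) (F y).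

Let hom_sym i j : hom i j -> hom j i.
Proof.
move=> ij x y Dx Dy.
by rewrite (br_anti LA Dx Dy) (br_anti LB (Fdeg Dx) (Fdeg Dy)) linN // linZ // ij.
Qed.

(** Degree [n + 2] is spanned by brackets [u, z], and Jacobi reduces [x, [u, z]] to brackets with
    [u] and with [z], covered by the degree 1 case and by induction. *)
Let hom_pos n i : hom i n.+1.
Proof.
elim: n i => [|n IH] i x y Dx; first by move=> Dy; apply: Fbr1 Dx Dy.
have sP : is_subspace (fun y => F (brA x y) - brB (F x) (F y) = 0).
  apply: subsp_preim (@subsp_zero _ _) => c z w.
  rewrite (br_linr LA) !linF (br_linr LB).
  by rewrite opprD addrACA -scalerBr.
move=> Dy; apply/eqP; rewrite -subr_eq0; apply/eqP; move: y Dy.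
apply: (free_plus_ind LA freeA sP) => u z Du Dz; apply/eqP; rewrite subr_eq0; apply/eqP.
have hom1 j : hom 1 j by apply: hom_sym; apply: Fbr1.
rewrite (br_jacobi LA z Dx Du) linD // linZ // (hom1 _ _ _ Du Dz).
rewrite (br_jacobi LB _ (Fdeg Dx) (Fdeg Du)) -(Fbr1 Dx Du).
rewrite (IH _ _ _ (br_deg LA Dx Du erefl) Dz).
by rewrite (hom1 _ _ _ Du (br_deg LA Dx Dz erefl)) (IH _ _ _ Dx Dz).
Qed.

(** For nonpositive degrees both sides are compared by bracketing with [F u], using injectivity in
    [ad_bij]; Jacobi leads to the degrees [(i, j + 1)] and [(j, i + 1)], closer to 1 in total. *)
Let hom_all i j : hom i j.
Proof.
have [n] := ubnP (absz (1 - i)%R + absz (1 - j)%R)%N; elim: n i j => // n IH i j ijn.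
have [j1|j0] := leP 1 j; first by have -> : j = `|j|.-1.+1 by lia.
have [i1|i0] := leP 1 i; first by apply: hom_sym; have -> : i = `|i|.-1.+1 by lia.
move=> x y Dx Dy; apply/eqP; rewrite -subr_eq0; apply/eqP.
have [|ad_inj _] := @adB (i + j); first by lia.
have Dxy : DA (i + j) (brA x y) by apply: (br_deg LA Dx Dy erefl).
apply: ad_inj => [|w Dw].
  apply: (subspB (grading_subspace grB _)); first exact: Fdeg.
  exact: (br_deg LB (Fdeg Dx) (Fdeg Dy) erefl).
have [u [Du ->]] : exists u, DA 1 u /\ w = F u.
  have De := e'1 Dw; exists (e' w); split=> //.
  by rewrite F1 ?e'K.
rewrite (linB (br_linl LB _)) -(Fbr1 Dxy Du) (br_jacobi_l LA u Dx Dy).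
rewrite (br_jacobi_l LB _ (Fdeg Dx) (Fdeg Dy)) linB // linZ //.
rewrite -(Fbr1 Dy Du) -(Fbr1 Dx Du).
have Dxu := br_deg LA Dx Du erefl; have Dyu := br_deg LA Dy Du erefl.
by rewrite (IH i (j + 1) _ _ _ Dx Dyu) ?(IH j (i + 1) _ _ _ Dy Dxu) ?subrr //; lia.
Qed.

Lemma extension_hom x y : F (brA x y) = brB (F x) (F y).
Proof.
have lin_defect x' : lin (fun y => F (brA x' y) - brB (F x') (F y)).
  by move=> c z w; rewrite (br_linr LA) !linF (br_linr LB) opprD addrACA -scalerBr.
apply/eqP; rewrite -subr_eq0; apply/eqP.
apply: (grading_ind grA (subsp_preim (lin_defect x) (@subsp_zero _ _))) y => j y Dy.
have lin_defect' : lin (fun x => F (brA x y) - brB (F x) (F y)).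
  by move=> c z w; rewrite (br_linl LA) !linF (br_linl LB) opprD addrACA -scalerBr.
apply: (grading_ind grA (subsp_preim lin_defect' (@subsp_zero _ _))) x => i x Dx.
by rewrite (hom_all Dx Dy) subrr.
Qed.

End Morphism.
End Extension.

(** * Stability under a generated subalgebra *)

Section MoreLieSuperalgebras.
Variables (K : fieldType) (A : lmodType K) (br : A -> A -> A) (D : int -> A -> Prop).
Hypothesis LA : LieSuper br D.
Let gr := LS_grading LA.

Lemma comp_br i k g x : D i g -> comp gr k (br g x) = br g (comp gr (k - i) x).
Proof.
move=> Dg; have l1 := lin_comp (comp_lin gr k) (br_linr LA g).
have l2 := lin_comp (br_linr LA g) (comp_lin gr (k - i)).
pose P x := comp gr k (br g x) - br g (comp gr (k - i) x) = 0.
suff : P x by move/eqP; rewrite subr_eq0 => /eqP.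
apply: (grading_ind gr) => [|j y Dy].
  apply: subsp_preim (@subsp_zero _ _) => c y z.
  by rewrite l1 l2 opprD addrACA -scalerBr.
have Dgy := br_deg LA Dg Dy erefl; rewrite /P.
have [jE|jk] := eqVneq (k - i) j.
  have kE : k = i + j by lia.
  by rewrite jE kE !comp_id // subrr.
by rewrite (comp_neq0 gr Dgy) ?(comp_neq0 gr Dy jk) ?(br0r LA) ?subrr //; lia.
Qed.

(** The elements all of whose components stabilise [M] form a graded subalgebra; working with
    components is what lets Jacobi apply. *)
Lemma gen_subalg_stable (G M : A -> Prop) :
  (forall g, G g -> exists k, D k g) -> is_subspace M ->
  (forall g y, G g -> M y -> M (br g y)) ->
  forall s y, gen_subalg br D G s -> M y -> M (br s y).
Proof.
move=> homG sM GM s y Gs; move: y.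
pose P s := forall k, True -> forall y, M y -> M (br (comp gr k s) y).
have sP : is_subspace P.
  apply: subsp_all => k _; apply: subsp_all => y _.
  exact: subsp_preim (lin_comp (br_linl LA y) (comp_lin gr k)) sM.
have Phom k x : D k x -> (forall y, M y -> M (br x y)) -> P x.
  move=> Dx Mx j _ y My; have [->|jk] := eqVneq j k; first by rewrite comp_id //; apply: Mx.
  by rewrite (comp_neq0 gr Dx jk) (br0l LA); case: sM.
suff Ps : P s.
  move=> y My; have [t [_ _ ->]] := comp_sum gr s; rewrite (lin_sum (br_linl LA y)).
  by apply: subsp_sum => // k _; apply: Ps.
apply: Gs => [|g Gg]; last first.
  by have [k Dg] := homG g Gg; apply: Phom Dg _ => y; apply: GM.
split=> // [x z Px Pz|]; last first.
  apply/(gradedP gr sP) => k x Px; apply: Phom (comp_deg gr k x) _ => y; exact: Px.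
have [t [_ _ ->]] := comp_sum gr x; rewrite (lin_sum (br_linl LA z)).
apply: subsp_sum => // i _.
have [t' [_ _ ->]] := comp_sum gr z; rewrite (lin_sum (br_linr LA _)).
apply: subsp_sum => // j _.
have [Dx Dz] := (comp_deg gr i x, comp_deg gr j z).
apply: Phom (br_deg LA Dx Dz erefl) _ => y My; rewrite (br_jacobi_l LA y Dx Dz).
have [_ _ MZ] := sM.
apply: subspB sM _ (MZ _ _ _); first by apply: Px => //; apply: Pz.
by apply: Pz => //; apply: Px.
Qed.

End MoreLieSuperalgebras.

(** * The ideal of [S] generated by [K] *)

Section Ideals.
Variables (K : fieldType) (A : lmodType K) (br : A -> A -> A) (D : int -> A -> Prop).
Hypothesis LA : LieSuper br D.
Hypothesis freeA : free_plus br D.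
Hypothesis two_neq0 : 2%:R != 0 :> K.
Variables (theta : A) (sigma : A -> A).
Hypothesis theta_deg : D (-1) theta.
Hypothesis lin_sigma : lin sigma.
Hypothesis sigma_br : forall u v, D 1 u -> D 1 v ->
  sigma (br u v) = (2%:R)^-1 *: (br (br theta u) v + br (br theta v) u).

Let gr := LS_grading LA.
Let RT := RTheta br D theta.
Let S := Ssub br D theta.

Lemma RTheta_deg r : RT r -> D (-1) r.
Proof.
apply=> // [|a y Da Dy]; first exact: grading_subspace.
exact: (br_deg LA Da Dy).
Qed.

Lemma RTheta_subspace : is_subspace RT.
Proof.
split=> [M [] //|x y Rx Ry M sM M1 Mt Mbr|c x Rx M sM M1 Mt Mbr]; case: (sM) => _ MD MZ.
  by apply: MD; [apply: Rx | apply: Ry].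
by apply: MZ; apply: Rx.
Qed.

Lemma RTheta_theta : RT theta.
Proof. by move=> M _ _. Qed.

Lemma RTheta_br a r : D 0 a -> RT r -> RT (br a r).
Proof. by move=> Da Rr M sM M1 Mt Mbr; apply: (Mbr) => //; apply: Rr. Qed.

Lemma Ssub_subalg : subalg br D S.
Proof. exact: subalg_gen. Qed.

Lemma Ssub_gen x : RT x \/ D 0 x \/ D 1 x -> S x.
Proof. exact: gen_subalg_gen. Qed.

Lemma Ssub_gen_homog x : RT x \/ D 0 x \/ D 1 x -> exists k, D k x.
Proof. by case=> [/RTheta_deg|[]]; [exists (-1) | exists 0 | exists 1]. Qed.

Lemma Ssub_deg2 x : D 2 x -> S x.
Proof.
have [sS Sbr _] := Ssub_subalg.
apply: (free_plus_ind LA freeA sS) => u v Du Dv.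
by apply: Sbr; apply: Ssub_gen; right; right.
Qed.

(* The degree [n + 1] part of the largest graded subspace in degrees [>= 2] that is stable
   under [R_Theta]; it turns out to be stable under [S] as well. *)
Fixpoint killed (n : nat) (x : A) : Prop :=
  if n is m.+1 then D n.+1 x /\ forall r, RT r -> killed m (br r x) else x = 0.

Lemma killed_subspace n : is_subspace (killed n).
Proof.
elim: n => [|n IH]; first exact: subsp_zero.
apply: subspI (grading_subspace gr _) _; apply: subsp_all => r _.
exact: subsp_preim (br_linr LA r) IH.
Qed.

Lemma killed_deg n x : killed n x -> D n.+1 x.
Proof. by case: n => [->|n []] //; case: (grading_subspace gr 1). Qed.

(** In the Jacobi expansion of [r, [a, x]], the element [r, a] is again in [RT], and [a, [r, x]]
    falls under induction. *)
Lemma killed_br0 n a x : D 0 a -> killed n x -> killed n (br a x).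
Proof.
move=> Da; elim: n x => [|n IH] x; first by move=> /= ->; rewrite (br0r LA).
case=> Dx Kx; split=> [|r Rr]; first exact: (br_deg LA Da Dx).
have Dr := RTheta_deg Rr; rewrite (br_jacobi LA x Dr Da).
have [_ KD KZ] := killed_subspace n.
apply: KD; last by apply/KZ/IH/Kx.
apply: Kx; rewrite (br_anti LA Dr Da); apply: (subspN RTheta_subspace).
by case: RTheta_subspace => _ _; apply; apply: RTheta_br.
Qed.

(** Here [r, u] has degree 0, so [killed_br0] handles the first Jacobi term and induction the
    second. *)
Lemma killed_br1 n u x : D 1 u -> killed n x -> killed n.+1 (br u x).
Proof.
move=> Du; elim: n x => [|n IH] x.
  by move=> /= ->; rewrite (br0r LA); case: (killed_subspace 1).
move=> Kx; have Dx := killed_deg Kx; case: (Kx) => _ Kr.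
split=> [|r Rr]; first by apply: (br_deg LA Du Dx); lia.
have Dr := RTheta_deg Rr; rewrite (br_jacobi LA x Dr Du).
have [_ KD KZ] := killed_subspace n.+1.
apply: KD; last by apply/KZ/IH/Kr.
by apply: killed_br0 Kx; apply: (br_deg LA Dr Du).
Qed.

(** As [killed 0] means zero, the component of degree 1 vanishes too. *)
Definition killed_ideal (x : A) : Prop :=
  S x /\ (forall k, k <= 0 -> comp gr k x = 0) /\ (forall n, True -> killed n (comp gr n.+1 x)).

Lemma killed_ideal_of : ideal_of br D S killed_ideal.
Proof.
have [sS Sbr gS] := Ssub_subalg.
have sM : is_subspace killed_ideal.
  apply: subspI sS (subspI _ _); apply: subsp_all => k _.
    exact: subsp_preim (comp_lin gr k) (@subsp_zero _ _).
  exact: subsp_preim (comp_lin gr _) (killed_subspace k).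
split=> // [x []//|x y Sx|]; last first.
  apply/(gradedP gr sM) => k x [Sx [x0 xK]]; split; first exact: (subalg_comp LA) Ssub_subalg Sx.
  split=> [j j0|n _]; rewrite comp_comp; first by case: eqP => // <-; apply: x0.
  case: eqP => [<-|_].
  - exact: xK.
  - by case: (killed_subspace n).
move: Sx => /(gen_subalg_stable LA Ssub_gen_homog sM); apply=> g {x y} y Gg [Sy [y0 yK]].
split; first by apply: Sbr => //; apply: Ssub_gen.
case: Gg => [Rg|[Dg|Dg]].
- have Dg := RTheta_deg Rg; split=> [k k0|n _]; rewrite (comp_br LA _ _ Dg) opprK.
    (* In the border case [k = 0] the bracket comes from degree 1, where [killed 0] gives zero. *)
    have [k1|k1] := leP (k + 1) 0; first by rewrite y0 // (br0r LA).
    have -> : k + 1 = 1 by lia.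
    by have /= -> := yK 0%N I; rewrite (br0r LA).
  have -> : n.+1%:Z + 1 = n.+2 by lia.
  by case: (yK n.+1 I) => _; apply.
- split=> [k k0|n _]; rewrite (comp_br LA _ _ Dg) subr0; first by rewrite y0 // (br0r LA).
  exact: killed_br0 (yK n I).
- split=> [k k0|n _]; rewrite (comp_br LA _ _ Dg); first by rewrite y0 ?(br0r LA) //; lia.
  case: n => [|n]; first by rewrite y0 //= (br0r LA).
  have -> : n.+2%:Z - 1 = n.+1 by lia.
  exact: killed_br1 (yK n I).
Qed.

(** It suffices to compare on brackets: [theta, [u, v]] = [[theta, u], v] - [u, [theta, v]], and -
    [u, [theta, v]] = [[theta, v], u] since [theta, v] has degree 0. *)
Lemma sigma_theta x : D 2 x -> sigma x = (2%:R)^-1 *: br theta x.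
Proof.
move=> Dx; apply/eqP; rewrite -subr_eq0; apply/eqP; move: x Dx.
have lin_defect : lin (fun x => sigma x - (2%:R)^-1 *: br theta x).
  move=> c x y; rewrite lin_sigma (br_linr LA) scalerDr scalerA mulrC -scalerA.
  by rewrite opprD addrACA -scalerBr.
apply: (free_plus_ind LA freeA (subsp_preim lin_defect (@subsp_zero _ _))) => u v Du Dv.
have Dtv := br_deg LA theta_deg Dv erefl.
rewrite sigma_br // (br_jacobi LA v theta_deg Du) (br_anti LA Du Dtv) /sgn /=.
by rewrite scale1r scaleN1r opprK subrr.
Qed.

(** If [sigma] vanishes on a submodule [M], then [theta] annihilates [M]; the annihilator of [M] in
    degree -1 is a submodule, so it contains [RT]. Conversely, [killed 1] is such a submodule. *)
Lemma KmodP x : Kmod br D sigma x <-> killed 1 x.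
Proof.
split=> [[M [sM M2 Mbr Msig Mx]]|Kx]; last first.
  exists (killed 1); split=> // [|y []//|a y|y [Dy Ky]]; first exact: killed_subspace.
    exact: killed_br0.
  by rewrite sigma_theta // (Ky _ RTheta_theta) scaler0.
split=> [|r Rr]; first exact: M2.
suff [_ kr] : D (-1) r /\ forall y, M y -> br r y = 0 by apply: kr.
apply: (Rr (fun r => D (-1) r /\ forall y, M y -> br r y = 0)) => [|y []//||a {Rr}r Da [Dr kr]].
- apply: subspI (grading_subspace gr _) _; apply: subsp_all => y _.
  exact: subsp_preim (br_linl LA y) (@subsp_zero _ _).
- split=> // y My; apply/eqP; have /eqP := Msig y My.
  by rewrite (sigma_theta (M2 y My)) scaler_eq0 invr_eq0 (negbTE two_neq0).
- split=> [|y My]; first exact: (br_deg LA Da Dr).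
  by rewrite (br_jacobi_l LA y Da Dr) (kr y My) (kr _ (Mbr _ _ Da My)) scaler0 (br0r LA) subrr.
Qed.

Let KI := Kideal br D theta sigma.

Lemma Kideal_killed x : KI x -> killed_ideal x.
Proof.
apply; first exact: killed_ideal_of.
move=> y /KmodP Ky; have Dy := killed_deg Ky.
split; first exact: Ssub_deg2.
split=> [k k0|n _]; first by apply: (comp_neq0 gr Dy); lia.
have [->|n1] := eqVneq n 1%N; first by rewrite comp_id.
by rewrite (comp_neq0 gr Dy); [case: (killed_subspace n) | lia].
Qed.

(** Dividing by the ideal generated by [K] thus leaves degrees up to 1 untouched. *)
Lemma Kideal_deg_ge2 x : KI x -> deg_ge D 2 x.
Proof.
move=> /Kideal_killed[_ [x0 xK]]; apply/(deg_geP gr) => k k2.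
have [/x0//|k0] := leP k 0; have -> : k = 1 by lia.
exact: (xK 0%N).
Qed.

Lemma Kideal_ideal_of : ideal_of br D S KI.
Proof.
split=> [|x /Kideal_killed[]//|x y Sx Ky M iM MK|s f us Df Kf k ks M iM MK].
- by split=> [M [[]]//|x y Kx Ky M iM MK|c x Kx M iM MK]; case: (iM) => -[_ MD MZ] _ _ _;
    [apply: MD; [apply: Kx | apply: Ky] | apply: MZ; apply: Kx].
- by case: (iM) => _ _ Mbr _; apply: Mbr => //; apply: Ky.
- by case: (iM) => _ _ _ gM; apply: gM us Df _ k ks; apply: Kf.
Qed.

Lemma Kideal_Kmod x : Kmod br D sigma x -> KI x.
Proof. by move=> Kx M _; apply. Qed.

End Ideals.

(** * The morphism from [bbU] to [U] given by a faithful action *)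

Lemma degree_retract (K : fieldType) (V A : lmodType K) (D : int -> A -> Prop)
    (gr : is_grading D) k (i : V -> A) : lin i -> injective i ->
  (forall a, D k a <-> exists v, a = i v) -> exists j : A -> V, lin j /\ cancel i j.
Proof.
move=> li inji Dk.
have /choice[j jP] : forall a, exists v, i v = comp gr k a.
  by move=> a; have /Dk[v ->] := comp_deg gr k a; exists v.
exists j; split=> [c x y|v]; apply: inji; first by rewrite li !jP comp_lin.
by rewrite jP comp_id //; apply/Dk; exists v.
Qed.

Section FaithfulExtension.
Variables (K : fieldType) (g : lmodType K) (brg : g -> g -> g) (V : lmodType K).
Variables (act : g -> V -> V) (A : lmodType K) (brA : A -> A -> A) (DA : int -> A -> Prop).
Variables (ig : g -> A) (iV : V -> A) (B : lmodType K) (brB : B -> B -> B).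
Variables (DB : int -> B -> Prop) (iW : V -> B).
Hypotheses (Hfaith : faithful act) (HU : is_bbU brg act brA DA ig iV).
Hypothesis HW : is_univ brB DB iW.

(** Injectivity holds in degree 1 by construction and in degree 0 by faithfulness. Below, F x = 0
    gives F [x, u] = 0, so [x, u] = 0 one degree higher, so x = 0 by [ad_bij]. *)
Lemma bbU_embedding : exists F : A -> B,
  [/\ lin F, (forall k x, DA k x -> DB k (F x)), (forall v, F (iV v) = iW v),
      (forall x y, F (brA x y) = brB (F x) (F y)) &
      (forall k x, k <= 1 -> DA k x -> F x = 0 -> x = 0)].
Proof.
have [LA [[lig injg] [lV injV]] [A0 A1] [_ gV] [adA freeA]] := HU.
have [LB [lW injW] B1 adB _] := HW.
have [jV [ljV jVK]] := degree_retract (LS_grading LA) lV injV A1.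
have [jW [ljW jWK]] := degree_retract (LS_grading LB) lW injW B1.
(* The two copies of [V] in degree 1 are identified; the retractions make both maps total and
   linear. *)
pose e x := iW (jV x); pose e' w := iV (jW w).
have le : lin e by apply: lin_comp.
have le' : lin e' by apply: lin_comp.
have e1 u : DA 1 u -> DB 1 (e u) by move=> _; apply/B1; exists (jV u).
have e'1 w : DB 1 w -> DA 1 (e' w) by move=> _; apply/A1; exists (jW w).
have e'K w : DB 1 w -> e (e' w) = w by move=> /B1[v ->]; rewrite /e /e' jVK jWK.
have eK u : DA 1 u -> e' (e u) = u by move=> /A1[v ->]; rewrite /e /e' jWK jVK.
have [F [lF Fdeg F1 Fbr1]] := ex_extension LA LB adB freeA le le' e1 e'1 eK.
have Fbr := extension_hom LA LB adB freeA e'1 e'K lF Fdeg F1 Fbr1.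
have DV v : DA 1 (iV v) by apply/A1; exists v.
have FV v : F (iV v) = iW v by rewrite F1 // /e jVK.
have FV0 u : DA 1 u -> F u = 0 -> u = 0.
  by move=> /A1[v ->]; rewrite FV -(lin0 lW) => /injW ->; rewrite (lin0 lV).
have Fu0 x u : F x = 0 -> F (brA x u) = 0 by move=> Fx; rewrite Fbr Fx (br0l LB).
exists F; split=> // k x; have [n] := ubnP (absz (1 - k)%R).
elim: n k x => // n IH k x kn k1 Dx Fx.
have [kE|k1'] := eqVneq k 1; first by apply: FV0 => //; rewrite -kE.
have [kE|k0] := eqVneq k 0.
  move: Dx Fx; rewrite kE => /A0[a ->] Fa; rewrite [a]Hfaith ?(lin0 lig) // => v.
  by apply: injV; rewrite (lin0 lV) -gV; apply: FV0; [rewrite gV | apply: Fu0].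
have [|ad_inj _] := adA k; first by lia.
apply: ad_inj => // u Du; apply: (IH (k + 1)); [lia | lia | | exact: Fu0].
exact: (br_deg LA Dx Du).
Qed.

End FaithfulExtension.

(** * Matching the two quotients *)

Section Quotient.
Variables (K : fieldType) (g : lmodType K) (brg : g -> g -> g) (V : lmodType K).
Variables (act : g -> V -> V) (Th : V -> g).
Variables (A : lmodType K) (brA : A -> A -> A) (DA : int -> A -> Prop).
Variables (ig : g -> A) (iV : V -> A) (theta : A) (sigma : A -> A).
Variables (B : lmodType K) (brB : B -> B -> B) (DB : int -> B -> Prop) (iW : V -> B).
Hypothesis two_neq0 : 2%:R != 0 :> K.
Hypotheses (Hsimple : simpleLie brg) (HTh : exists v, Th v != 0).
Hypotheses (HU : is_bbU brg act brA DA ig iV) (HW : is_univ brB DB iW).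
Hypotheses (theta_deg : DA (-1) theta) (theta_br : forall u, brA theta (iV u) = ig (Th u)).
Hypotheses (lin_sigma : lin sigma) (sigma_br : forall u v, DA 1 u -> DA 1 v ->
  sigma (brA u v) = (2%:R)^-1 *: (brA (brA theta u) v + brA (brA theta v) u)).
Variable F : A -> B.
Hypotheses (linF : lin F) (Fdeg : forall k x, DA k x -> DB k (F x)).
Hypotheses (FV : forall v, F (iV v) = iW v) (Fbr : forall x y, F (brA x y) = brB (F x) (F y)).
Hypothesis Finj : forall k x, k <= 1 -> DA k x -> F x = 0 -> x = 0.

Let LA : LieSuper brA DA. Proof. by case: HU. Qed.
Let LB : LieSuper brB DB. Proof. by case: HW. Qed.
Let freeA : free_plus brA DA. Proof. by case: HU => _ _ _ _ []. Qed.
Let A0 a : DA 0 a <-> exists x, a = ig x. Proof. by case: HU => _ _ [h _] _ _; apply: h. Qed.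
Let A1 a : DA 1 a <-> exists v, a = iV v. Proof. by case: HU => _ _ [_ h] _ _; apply: h. Qed.
Let B1 b : DB 1 b <-> exists v, b = iW v. Proof. by case: HW => _ _ h _ _; apply: h. Qed.
Let adB k : k <= 0 -> ad_bij brB DB k. Proof. by case: HW => _ _ _ h _; apply: h. Qed.
Let grA := LS_grading LA.
Let grB := LS_grading LB.
Let RT := RTheta brA DA theta.
Let S := Ssub brA DA theta.
Let KI := Kideal brA DA theta sigma.

(** The subspace T_{-1} of the theorem. *)
Definition imRTheta (y : B) : Prop := exists r, RT r /\ F r = y.
Let P := Ptil brB DB imRTheta.

(** By Jacobi the brackets [r, u] span an ideal of [g]; it contains the values [theta, v] of [Th],
    hence is nonzero, and simplicity makes it everything. *)
Lemma bbU0_span a : DA 0 a ->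
  span (fun y => exists r u, [/\ RT r, DA 1 u & y = brA r u]) a.
Proof.
set G := (fun y => _); have sG := span_subspace G.
have [_ [[lig _] _] _ [igbr _] _] := HU.
have [_ /(_ (fun x => span G (ig x)))[]] := Hsimple.
- split=> [|x y /(_ (fun z => span G (brA (ig x) z)))]; first exact: subsp_preim lig sG.
  rewrite igbr; apply=> [|_ [r [u [Rr Du ->]]]]; first exact: subsp_preim (br_linr LA _) sG.
  have Dx : DA 0 (ig x) by apply/A0; exists x.
  rewrite (br_jacobi LA u Dx (RTheta_deg LA theta_deg Rr)).
  have [_ GD GZ] := sG; apply: GD; last apply: GZ; apply: span_gen.
    by exists (brA (ig x) r), u; split=> //; apply: RTheta_br.
  by exists r, (brA (ig x) u); split=> //; apply: (br_deg LA Dx Du).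
- move=> G0; have [v /eqP[]] := HTh; apply: G0; apply: span_gen.
  by exists theta, (iV v); split; [apply: RTheta_theta | apply/A1; exists v | rewrite theta_br].
- by move=> Gall /A0[x ->].
Qed.

Lemma imRTheta_subspace : is_subspace imRTheta.
Proof. exact: subsp_im linF (RTheta_subspace _ _ _). Qed.

Lemma imRTheta_deg y : imRTheta y -> DB (-1) y.
Proof. by case=> r [Rr <-]; apply/Fdeg/(RTheta_deg LA theta_deg). Qed.

Lemma F_comp k x : F (comp grA k x) = comp grB k (F x).
Proof.
have l1 := lin_comp linF (comp_lin grA k); have l2 := lin_comp (comp_lin grB k) linF.
pose Q x := F (comp grA k x) - comp grB k (F x) = 0.
suff : Q x by move/eqP; rewrite subr_eq0 => /eqP.
apply: (grading_ind grA) => [|j y Dy].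
  apply: subsp_preim (@subsp_zero _ _) => c y z.
  by rewrite l1 l2 opprD addrACA -scalerBr.
rewrite /Q; have [->|kj] := eqVneq k j; first by rewrite !comp_id ?subrr //; apply: Fdeg.
by rewrite (comp_neq0 grA Dy kj) (comp_neq0 grB (Fdeg Dy) kj) (lin0 linF) subrr.
Qed.

Lemma Ptil_subalg : subalg brB DB P.
Proof. exact: subalg_gen. Qed.

Lemma Ptil_F1 u : DA 1 u -> P (F u).
Proof. by move=> Du; apply: gen_subalg_gen; left; apply: Fdeg. Qed.

(** Only the generators of degree 0 are not visibly sent into [P]; [bbU0_span] turns them into sums
    of brackets. *)
Lemma Ptil_F x : S x -> P (F x).
Proof.
have [sP Pbr gP] := Ptil_subalg.
have PRT r : RT r -> P (F r) by move=> Rr; apply: gen_subalg_gen; right; exists r.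
move=> /(_ (fun x => P (F x))); apply=> [|y [/PRT//|[/bbU0_span|/Ptil_F1//]]]; last first.
  move=> /(_ (fun y => P (F y))); apply=> [|_ [r [u [Rr Du ->]]]].
    exact: subsp_preim linF sP.
  by rewrite Fbr; apply: Pbr; [apply: PRT | apply: Ptil_F1].
split=> [|y z Py Pz|]; first exact: subsp_preim linF sP.
  by rewrite Fbr; apply: Pbr.
apply/(gradedP grA (subsp_preim linF sP)) => k y Py.
by rewrite F_comp; apply: (subalg_comp LB) Ptil_subalg Py.
Qed.

Lemma Ptil_lift y : P y -> exists x, S x /\ F x = y.
Proof.
have [sS Sbr gS] := Ssub_subalg brA DA theta.
have sI := subsp_im linF sS.
move=> /(_ (fun y => exists x, S x /\ F x = y)); apply=> [|z [/B1[v ->]|[r [Rr <-]]]].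
- split=> // [_ _ [x [Sx <-]] [z [Sz <-]]|].
    by exists (brA x z); split; [apply: Sbr | apply: Fbr].
  apply/(gradedP grB sI) => k _ [x [Sx <-]]; rewrite -F_comp.
  by exists (comp grA k x); split=> //; apply: (subalg_comp LA) (Ssub_subalg brA DA theta) Sx.
- by exists (iV v); split=> //; apply: Ssub_gen; right; right; apply/A1; exists v.
- by exists r; split=> //; apply: Ssub_gen; left.
Qed.

Lemma Pker0 : Pker brB DB imRTheta 0.
Proof.
exists (fun y => y = 0); split=> //; split; first exact: subsp_zero.
- by move=> _ ->; case: Ptil_subalg => -[].
- by move=> x _ _ ->; rewrite (br0r LB).
- by apply/(gradedP grB (@subsp_zero _ _)) => k _ ->; rewrite (lin0 (comp_lin grB k)).
Qed.

(** The image of [M] is an ideal because [F] maps [S] onto [P]. *)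
Lemma Lker_Pker x : Lker brA DA theta sigma x -> Pker brB DB imRTheta (F x).
Proof.
case=> M [[sM MS Mbr gM] KM Mdec Mx].
have sI := subsp_im linF sM.
exists (fun y => exists z, M z /\ F z = y); split; last by exists x.
  split=> // [_ [z [Mz <-]]|y _ /Ptil_lift[s [Ss <-]] [z [Mz <-]]|].
  - by apply: Ptil_F; apply: MS.
  - by exists (brA s z); split; [apply: Mbr | apply: Fbr].
  - apply/(gradedP grB sI) => k _ [z [Mz <-]]; rewrite -F_comp.
    by exists (comp grA k z); split=> //; move/(gradedP grA sM): gM; apply.
move=> _ [z [Mz <-]] [a [b [c [Da Db Dc FE]]]].
(* Degrees from 2 on vanish in [a + b + c]; degrees up to 1 vanish because [z] lies in [KI] plus
   degrees at least 3. *)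
apply: (@comp_eq _ _ _ grB) => k; rewrite [RHS](lin0 (comp_lin grB k)).
have [k2|k2] := leP 2 k.
  rewrite FE !(linD (comp_lin grB k)) (comp_neq0 grB Da) ?(comp_neq0 grB Db) ?(comp_neq0 grB Dc);
    by rewrite ?addr0 //; lia.
have [y [w [Ky _ Dw ->]]] := Mdec z Mz.
rewrite -F_comp (linD (comp_lin grA k)).
have /(deg_geP grA) -> // := Kideal_deg_ge2 LA freeA two_neq0 theta_deg lin_sigma sigma_br Ky.
by move/(deg_geP grA): Dw => ->; rewrite ?addr0 ?(lin0 linF) //; lia.
Qed.

(** Below degree -1, [y, u] is in the ideal one degree higher, hence zero, and [ad_bij] gives y =
    0. *)
Lemma Pideal_deg_le1 (M : B -> Prop) : ideal_of brB DB P M ->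
  (forall y, M y -> (exists a b c, [/\ DB (-1) a, DB 0 b, DB 1 c & y = a + b + c]) -> y = 0) ->
  forall k y, k <= 1 -> DB k y -> M y -> y = 0.
Proof.
move=> [sM MP Mbr _] Mloc k y; have [n] := ubnP (absz (1 - k)%R).
elim: n k y => // n IH k y kn k1 Dy My.
have B0 j : DB j 0 by case: (grading_subspace grB j).
have [kE|km1] := eqVneq k (-1).
  by apply: Mloc => //; exists y, 0, 0; split=> //; [rewrite -kE | rewrite !addr0].
have [kE|k0] := eqVneq k 0.
  by apply: Mloc => //; exists 0, y, 0; split=> //; [rewrite -kE | rewrite add0r addr0].
have [kE|k1'] := eqVneq k 1.
  by apply: Mloc => //; exists 0, 0, y; split=> //; [rewrite -kE | rewrite !add0r].
have [|ad_inj _] := @adB k; first by lia.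
apply: ad_inj => // u Du; apply: (IH (k + 1)); [lia | lia | exact: (br_deg LB Dy Du) | ].
rewrite (br_anti LB Dy Du); apply: (subspN sM); case: (sM) => _ _; apply; apply: Mbr => //.
by apply: gen_subalg_gen; left.
Qed.

(** The witness is the ideal [KN], the sum of [KI] and the preimage [N] of [M] in [S]. *)
Lemma Pker_Lker x : S x -> Pker brB DB imRTheta (F x) -> Lker brA DA theta sigma x.
Proof.
move=> Sx [M [iM Mloc Mx]]; have M0 := Pideal_deg_le1 iM Mloc.
have [sM MP Mbr gM] := iM; have {}gM k y : M y -> M (comp grB k y).
  by move/(gradedP grB sM): gM; apply.
have [sS Sbr _] := Ssub_subalg brA DA theta.
have Scomp k y : S y -> S (comp grA k y).
  exact: (subalg_comp LA) (Ssub_subalg brA DA theta).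
have iK := Kideal_ideal_of LA freeA two_neq0 theta_deg lin_sigma sigma_br.
have [sK KS Kbr gK] := iK.
pose N z := S z /\ M (F z).
have sN : is_subspace N := subspI sS (subsp_preim linF sM).
pose KN y := exists k z, [/\ KI k, N z & y = k + z].
have sKN : is_subspace KN.
  have [[K0 KD KZ] [N0 ND NZ]] := (sK, sN); split; first by exists 0, 0; rewrite addr0.
    move=> _ _ [k [z [Kk Nz ->]]] [k' [z' [Kk' Nz' ->]]].
    by exists (k + k'), (z + z'); rewrite addrACA; split=> //; [apply: KD | apply: ND].
  move=> c _ [k [z [Kk Nz ->]]]; exists (c *: k), (c *: z).
  by rewrite scalerDr; split=> //; [apply: KZ | apply: NZ].
have K0 : KI 0 by case: sK.
have N0 : N 0 by case: sN.
exists KN; split.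
- split=> // [_ [k [z [Kk [Sz _] ->]]]|y _ Sy [k [z [Kk [Sz Mz] ->]]]|].
  + by case: sS => _ SD _; apply: SD => //; apply: KS.
  + exists (brA y k), (brA y z); rewrite (linD (br_linr LA y)); split=> //; first exact: Kbr.
    by split; [apply: Sbr | rewrite Fbr; apply: Mbr => //; apply: Ptil_F].
  + apply/(gradedP grA sKN) => j _ [k [z [Kk [Sz Mz] ->]]].
    exists (comp grA j k), (comp grA j z); rewrite (linD (comp_lin grA j)); split=> //.
      by move/(gradedP grA sK): gK; apply.
    by split; [apply: Scomp | rewrite F_comp; apply: gM].
- by move=> y Ky; exists y, 0; rewrite addr0.
- move=> _ [k [z [Kk [Sz Mz] ->]]].
  have Mzk j : M (F (comp grA j z)) by rewrite F_comp; apply: gM.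
  (* For [r] in [RT] and z_2 the degree 2 component, [r, z_2] has degree 1 and image in [M], so it
     vanishes: z_2 lies in [K]. *)
  have z2 : KI (comp grA 2 z).
    apply: Kideal_Kmod; apply/(KmodP LA freeA two_neq0 theta_deg lin_sigma sigma_br).
    split=> [|r Rr]; first exact: comp_deg.
    have D1 := br_deg LA (RTheta_deg LA theta_deg Rr) (comp_deg grA 2 z) erefl.
    apply: (Finj _ D1) => //; apply: (M0 _ _ _ (Fdeg D1)) => //; rewrite Fbr.
    by apply: Mbr => //; apply: Ptil_F; apply: Ssub_gen; left.
  (* Moving z_2 to the [KI] summand leaves a remainder in degrees at least 3. *)
  have [_ KD _] := sK; exists (k + comp grA 2 z), (z - comp grA 2 z); split.
  + exact: KD.
  + by apply: (subspB sS) => //; apply: Scomp.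
  + apply/(deg_geP grA) => j j3; rewrite (linB (comp_lin grA j)) comp_comp.
    case: eqP => [->|j2]; first by rewrite subrr.
    rewrite subr0; have Dz := comp_deg grA j z; have j1 : j <= 1 by lia.
    apply: (Finj j1 Dz); exact: (M0 _ _ j1 (Fdeg Dz)).
  + by rewrite -addrA [_ + (z - _)]addrC subrK.
- by exists 0, x; rewrite add0r.
Qed.

(** [F] is a morphism before any quotient, so the congruences modulo [Pker] hold as equalities. *)
Lemma quot_iso_F :
  quot_iso brA DA brB DB S (Lker brA DA theta sigma) P (Pker brB DB imRTheta).
Proof.
exists F; split.
- by split=> // k x _; apply: Fdeg.
- exact: Ptil_F.
- by move=> x y _ _; rewrite Fbr subrr; apply: Pker0.
- by move=> x Sx; split; [apply: Pker_Lker | apply: Lker_Pker].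
- by move=> y /Ptil_lift[x [Sx <-]]; exists x; rewrite subrr; split=> //; apply: Pker0.
Qed.

End Quotient.

Theorem theorem4p9 (R : realType) (b : bool)
  (g : lmodType (ground R b)) (brg : g -> g -> g)
  (V : lmodType (ground R b)) (act : g -> V -> V) (Th : V -> g)
  (HLL : LieLeibnizTriple brg act Th)
  (Hsimple : simpleLie brg) (Hfaith : faithful act) (HTh : exists v, Th v != 0)
  (* the Lie superalgebra bbU = bbU(g, V) *)
  (A : lmodType (ground R b)) (brA : A -> A -> A) (DA : int -> A -> Prop)
  (ig : g -> A) (iV : V -> A) (HU : is_bbU brg act brA DA ig iV)
  (* Theta regarded as an element of bbU_{-1} *)
  (theta : A) (Htheta1 : DA (-1) theta)
  (Htheta2 : forall u, brA theta (iV u) = ig (Th u))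
  (* sigma : bbU_2 -> bbU_1 *)
  (sigma : A -> A) (Hsig1 : lin sigma) (Hsig2 : forall y, DA 2 y -> DA 1 (sigma y))
  (Hsig3 : forall u v, DA 1 u -> DA 1 v ->
     sigma (brA u v) = (2%:R)^-1 *: (brA (brA theta u) v + brA (brA theta v) u))
  (* the universal Lie superalgebra U associated to U_1 = V[-1] *)
  (B : lmodType (ground R b)) (brB : B -> B -> B) (DB : int -> B -> Prop)
  (iW : V -> B) (HW : is_univ brB DB iW) :
  exists T : B -> Prop,
    [/\ is_subspace T, (forall y, T y -> DB (-1) y) &
        quot_iso brA DA brB DB (Ssub brA DA theta) (Lker brA DA theta sigma)
                 (Ptil brB DB T) (Pker brB DB T)].
Proof.

(* Both ground fields have characteristic 0. *)
have two_neq0 : 2%:R != 0 :> ground R b by case: (b); rewrite /= pnatr_eq0.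
have [F [linF Fdeg FV Fbr Finj]] := bbU_embedding Hfaith HU HW.
exists (imRTheta brA DA theta F); split.
- exact: imRTheta_subspace.
- by move=> y; apply: (imRTheta_deg HU Htheta1 Fdeg).
- exact: (quot_iso_F two_neq0 Hsimple HTh HU HW Htheta1 Htheta2 Hsig1 Hsig3 linF Fdeg FV Fbr Finj).
Qed.
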